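(* Let $n$ be a positive integer. For each $\lambda\in\mathcal{G_I'}(n)$ let $\mathcal{G}_\lambda=\{\varrho_i(\lambda):1\leq i\leq m(\lambda)\}$. Then the sets $\mathcal{G}_\lambda$, $\lambda\in\mathcal{G_I'}(n)$, are pairwise disjoint and \[ \mathcal{G}(n)\setminus\mathcal{G}^0(n)=\bigcup_{\lambda\in\mathcal{G_I'}(n)}\mathcal{G}_\lambda . \]
   Context: A partition is a finite multiset of positive integers; $\bar{\ell}(\lambda)$ is its number of distinct part values and $m(\lambda)$ the multiplicity of its largest part. A partition is gap-free if its distinct part values are consecutive integers. $\mathcal{G}(n)$ is the set of gap-free partitions of $n$; $\mathcal{G}^0(n)$ is the set of partitions of $n$ with exactly one distinct part value; $\mathcal{G_I'}(n)$ is the set of gap-free partitions of $n$ with smallest part $1$ and even largest part. For a gap-free partition $\mu$ with at least $r$ distinct parts, $\xi_r(\mu)$ is obtained by taking the $r$ smallest distinct part values $v$ of $\mu$ and, for each simultaneously, replacing one copy of $v$ by $v+1$. For a gap-free partition $\lambda$ with smallest part $1$, largest part $\ell=\bar{\ell}(\lambda)$ of multiplicity $m(\lambda)$, and $1\leq i\leq m(\lambda)$: let $\lambda^i_1$ be $\lambda$ with $i-1$ copies of $\ell$ deleted, let $\lambda^i_j=\xi_\ell(\lambda^i_{j-1})$ for $2\leq j\leq i$, and set $\varrho_i(\lambda)=\lambda^i_i$ (at each step $\xi_\ell$ is applied to a gap-free partition with at least $\ell$ distinct parts, so this is defined). *)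

(* Defs.v *)
From mathcomp Require Import all_boot all_order.
From mathcomp Require Import finmap multiset.
From mathcomp Require Import classical_sets.
Set Implicit Arguments.
Unset Strict Implicit.
Unset Printing Implicit Defensive.

Local Open Scope mset_scope.
Local Open Scope classical_set_scope.
Local Open Scope nat_scope.

(* For [mu : {mset nat}] and [v : nat], [mu v] is the multiplicity of [v] in
   [mu], and [mu] coerces to the list of its elements with repetition. *)

Definition is_partition_of (n : nat) (mu : {mset nat}) : bool :=
  (0 \notin mu) && (\sum_(v <- mu) v == n).

(* The distinct part values, in increasing order. *)
Definition values (mu : {mset nat}) : seq nat := sort leq (finsupp mu).

Definition ellbar (mu : {mset nat}) : nat := size (values mu).

(* The default value 0 is only returned for the empty partition. *)
Definition smallest_part (mu : {mset nat}) : nat := head 0 (values mu).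
Definition largest_part (mu : {mset nat}) : nat := last 0 (values mu).

Definition mult_largest (mu : {mset nat}) : nat := mu (largest_part mu).

Definition gap_free (mu : {mset nat}) : bool :=
  sorted (fun u v => v == u.+1) (values mu).

Definition G (n : nat) : set {mset nat} :=
  [set mu | is_partition_of n mu /\ gap_free mu].

Definition G0 (n : nat) : set {mset nat} :=
  [set mu | is_partition_of n mu /\ ellbar mu = 1].

Definition GI' (n : nat) : set {mset nat} :=
  [set mu | [/\ G n mu, smallest_part mu = 1 & ~~ odd (largest_part mu)]].

(* Subtracting all the [v] before adding all the [v.+1] makes the replacements
   simultaneous.  Only meaningful when [r <= ellbar mu]: [take] silently
   truncates otherwise. *)
Definition xi (r : nat) (mu : {mset nat}) : {mset nat} :=
  let vs := take r (values mu) in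
  ((mu `\` seq_mset vs) `+` seq_mset [seq v.+1 | v <- vs])%mset.

(* [rho_step lam i j] is $\lambda^i_j$, for [1 <= j <= i <= mult_largest lam];
   [ellbar lam] is the largest part of [lam] when [lam] is gap-free with
   smallest part 1. *)
Definition rho_step (lam : {mset nat}) (i j : nat) : {mset nat} :=
  iter j.-1 (xi (ellbar lam)) (lam `\` msetn i.-1 (ellbar lam))%mset.

Definition varrho (i : nat) (lam : {mset nat}) : {mset nat} :=
  rho_step lam i i.

Definition Gset (lam : {mset nat}) : set {mset nat} :=
  [set varrho i lam | i in [set i | 1 <= i <= mult_largest lam]].

(* Main.v *)
(** On a partition with set of values [a, ..., a + l - 1] or [a, ..., a + l], the
    map xi_l only turns one smallest part a into a + l.  Turning one largest
    part M into M - l inverts it, and this can be iterated until the values are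
    exactly [1, ..., l]; the number j of iterations is determined because a part
    a + l > l is created by every application of xi_l.  Adding back j copies of
    l then gives the unique (lambda, i = j + 1).  Since l is even and the number
    of distinct parts is l or l + 1, l is determined by the partition. *)
Require Import Defs.
From mathcomp Require Import all_boot all_order.
From mathcomp Require Import finmap multiset.
From mathcomp Require Import classical_sets.
From mathcomp Require Import zify_ssreflect.

Set Implicit Arguments.
Unset Strict Implicit.
Unset Printing Implicit Defensive.

Local Open Scope mset_scope.
Local Open Scope classical_set_scope.
Local Open Scope nat_scope.

(* Quantifies over [nat] itself rather than the carrier of its [choiceType],
   which [lia] would not recognize. *)
Lemma nat_msetP (mu nu : {mset nat}) :
  (forall v : nat, mu v = nu v) <-> mu = nu.
Proof. exact: msetP. Qed.

Lemma msetn_eqM k (a v : nat) : (msetn k a) v = (v == a) * k.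
Proof. by rewrite msetnE; case: eqP; rewrite ?mul1n. Qed.

Lemma nat_msetE2 (mu nu : {mset nat}) (v : nat) :
  ((mu `+` nu)%mset v = mu v + nu v) * ((mu `\` nu)%mset v = mu v - nu v).
Proof. by split; rewrite msetE2. Qed.

Definition msetE := (nat_msetE2, msetn_eqM).

Lemma mem_values (mu : {mset nat}) v : (v \in values mu) = (0 < mu v).
Proof. by rewrite mem_sort msuppE in_mset. Qed.

(** Strictly increasing lists with the same members are equal. Claims about the set of values thus
    become linear arithmetic on multiplicities, one [v] at a time. *)
Lemma values_iotaP (mu : {mset nat}) a d :
  values mu = iota a d <-> forall v : nat, (0 < mu v) = (a <= v < a + d).
Proof.
split=> [E v|E]; first by rewrite -mem_values E mem_iota.
apply: (irr_sorted_eq ltn_trans ltnn) => [||v].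
- by rewrite ltn_sorted_uniq_leq sort_uniq fset_uniq (sort_sorted leq_total).
- exact: iota_ltn_sorted.
- by rewrite mem_values mem_iota E.
Qed.

Lemma gap_freeP (mu : {mset nat}) :
  gap_free mu <-> exists a d, values mu = iota a d.
Proof.
rewrite /gap_free; split=> [|[a [d ->]]]; last first.
  by case: d a => //= d a; elim: d a => //= d IH a; rewrite eqxx IH.
case: (values mu) => [|a s] /=; first by exists 0, 0.
move=> H; exists a, (size s).+1; congr cons.
by elim: s a H => //= b s IH a /andP[/eqP-> /IH {1}->].
Qed.

Definition weight (mu : {mset nat}) : nat := \sum_(v <- mu) v.

Lemma weightD (mu nu : {mset nat}) :
  weight (mu `+` nu)%mset = weight mu + weight nu.
Proof.
rewrite /weight -big_cat; apply: perm_big; apply/permP => P.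
suff /permP: perm_eq (mu `+` nu)%mset (mu ++ nu) by [].
by apply/allP => v _ /=; rewrite count_cat !count_mem_mset !msetE.
Qed.

Lemma weight_msetn k a : weight (msetn k a) = k * a.
Proof. by rewrite /weight enum_msetn big_nseq iter_addn_0 mulnC. Qed.

(* All the replacements but the first and the last cancel out. *)
Lemma xiE l a (e : bool) (mu : {mset nat}) : 0 < l ->
  values mu = iota a (l + e) -> xi l mu = ((a + l) +` (mu `\ a))%mset.
Proof.
move=> l0 E; have /values_iotaP S := E.
have T : take l (values mu) = iota a l.
  by rewrite E iotaD take_size_cat ?size_iota.
have M : [seq v.+1 | v <- iota a l] = iota a.+1 l by rewrite -(iotaDl 1 a l).
apply/nat_msetP => v; have := S v; rewrite /xi T M !msetE !mset_seqE.
by rewrite !count_uniq_mem ?iota_uniq // !mem_iota; lia.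
Qed.

Lemma weight_xi l a (e : bool) (mu : {mset nat}) : 0 < l ->
  values mu = iota a (l + e) ->
  weight (xi l mu) = weight mu + l.
Proof.
move=> l0 E; have /values_iotaP S := E.
rewrite (xiE l0 E) weightD weight_msetn.
have a_mu : a \in mu by rewrite in_mset S; lia.
rewrite -[in RHS](msetB1K a_mu) weightD weight_msetn; lia.
Qed.

Lemma values_xi l a (e : bool) (mu : {mset nat}) : 0 < l ->
  values mu = iota a (l + e) ->
  exists2 b, a <= b & exists e' : bool, values (xi l mu) = iota b (l + e').
Proof.
move=> l0 E; have /values_iotaP S := E; rewrite (xiE l0 E).
(* The new largest part is [a + l]; the smallest part moves up exactly when the only copy of [a] is
   used. *)
exists (a + (mu a == 1)); first lia; exists (1 < mu a).
apply/values_iotaP => v; have := S v; have := S a; rewrite !msetE.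
by have [->|] := eqVneq v a; lia.
Qed.

Lemma values_iter_xi l (mu : {mset nat}) j : 0 < l -> values mu = iota 1 l ->
  [/\ exists2 b, 0 < b &
        exists e : bool, values (iter j (xi l) mu) = iota b (l + e)
    & weight (iter j (xi l) mu) = weight mu + j * l].
Proof.
move=> l0 E; elim: j => [|j [[b b0 [e Eb]] sj]] /=.
  by split; [exists 1; last exists false; rewrite ?addn0 | rewrite addn0].
have [c bc Ec] := values_xi l0 Eb.
split; first by exists c; first exact: leq_trans bc.
by rewrite (weight_xi l0 Eb) sj; lia.
Qed.

(** The largest part of the image is the smallest part of the argument plus [l], so equal images
    force [a = b]; the single move can then be undone. *)
Lemma xi_inj l a b (e f : bool) (mu nu : {mset nat}) : 0 < l ->
  values mu = iota a (l + e) -> values nu = iota b (l + f) ->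
  xi l mu = xi l nu -> mu = nu.
Proof.
move=> l0.
have le_ab (c d : nat) (g h : bool) (ka la : {mset nat}) :
    values ka = iota c (l + g) -> values la = iota d (l + h) ->
    xi l ka = xi l la -> c <= d.
  move=> Ec Ed; rewrite (xiE l0 Ec) (xiE l0 Ed) => /nat_msetP/(_ (c + l)).
  have /values_iotaP/(_ (c + l)) := Ed; rewrite !msetE eqxx.
  by case: (la (c + l)) => [|k]; lia.
move=> Ea Eb X; have ab : a = b.
  by apply/eqP; rewrite eqn_leq (le_ab _ _ _ _ _ _ Ea Eb X)
    (le_ab _ _ _ _ _ _ Eb Ea (esym X)).
subst b; move: X; rewrite (xiE l0 Ea) (xiE l0 Eb).
move=> /(congr1 (fun ka => ka `\ (a + l))%mset); rewrite !msetD1K => X.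
have a_mu : a \in mu by rewrite in_mset; move/values_iotaP: Ea ->; lia.
have a_nu : a \in nu by rewrite in_mset; move/values_iotaP: Eb ->; lia.
by rewrite -(msetB1K a_mu) X msetB1K.
Qed.

Lemma xi_surj l a (e : bool) (nu : {mset nat}) : 0 < l -> 1 < a + e ->
  values nu = iota a (l + e) ->
  exists mu b (e' : bool),
    [/\ 0 < b, values mu = iota b (l + e') & xi l mu = nu].
Proof.
move=> l0 ae /values_iotaP S.
(* The largest part of [nu] is [b + l]; it remains a value after one copy is turned into [b] iff it
   has a second copy. The bound [1 < a + e] gives [b > 0]. *)
pose b := (a + e).-1.
have SM := S (b + l).
have E : values (b +` (nu `\ (b + l)))%mset = iota b (l + (1 < nu (b + l))).
  apply/values_iotaP => v; have := S v; rewrite !msetE.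
  by have [->|] := eqVneq v (b + l); rewrite /b in SM *; lia.
exists (b +` (nu `\ (b + l)))%mset, b, (1 < nu (b + l)); split=> //.
  by rewrite /b; lia.
rewrite (xiE l0 E); apply/nat_msetP => v; rewrite !msetE.
by have [->|] := eqVneq v (b + l); rewrite /b in SM *; lia.
Qed.

Lemma iter_xi_surj l a (e : bool) (nu : {mset nat}) : 0 < l -> 0 < a ->
  values nu = iota a (l + e) ->
  exists j mu, values mu = iota 1 l /\ nu = iter j (xi l) mu.
Proof.
move=> l0.
(* A preimage under [xi l] weighs [l] less, so the descent ends, with [a = 1] and [e = false]. *)
have [N] := ubnP (weight nu); elim: N => // N IH in a e nu *.
move=> leN a0 E; have [ae|ae] := ltnP 1 (a + e); last first.
  exists 0, nu; split=> //; rewrite E.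
  by congr iota; lia.
have [mu [b [f [b0 Emu xi_mu]]]] := xi_surj l0 ae E.
have s := weight_xi l0 Emu.
have [|j [mu0 [E0 Ej]]] := IH b f mu _ b0 Emu; first by rewrite xi_mu in s; lia.
by exists j.+1, mu0; rewrite /= -Ej.
Qed.

Lemma iter_xi_inj l i j (mu nu : {mset nat}) : 0 < l ->
  values mu = iota 1 l -> values nu = iota 1 l ->
  iter i (xi l) mu = iter j (xi l) nu -> i = j /\ mu = nu.
Proof.
move=> l0.
have not_base k (ka la : {mset nat}) : values ka = iota 1 l ->
    values la = iota 1 l -> la <> iter k.+1 (xi l) ka.
  move=> Ek /values_iotaP Sla.
  have [[b b1 [e Eb]] _] := values_iter_xi k l0 Ek.
  rewrite /= (xiE l0 Eb) => /nat_msetP /(_ (b + l)).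
  by have := Sla (b + l); rewrite !msetE; lia.
move=> Em En; elim: i j => [|i IH] [|j] //.
- by move=> /not_base; case.
- by move=> /esym /not_base; case.
have [[b _ [e Eb]] _] := values_iter_xi i l0 Em.
have [[c _ [f Ec]] _] := values_iter_xi j l0 En.
by move=> /(xi_inj l0 Eb Ec) /IH[-> ->].
Qed.

Lemma largest_part_iota (mu : {mset nat}) l : 0 < l ->
  values mu = iota 1 l -> largest_part mu = l.
Proof.
by move=> l0 E; rewrite /largest_part E -nth_last size_iota nth_iota; lia.
Qed.

Lemma GI'P n (lam : {mset nat}) : 0 < n -> GI' n lam <->
  exists l, [/\ 0 < l, ~~ odd l, values lam = iota 1 l & weight lam = n].
Proof.
move=> n0; split.
  move=> [[/andP[_ /eqP sn] /gap_freeP[a [[|l] E]]]].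
    by rewrite /smallest_part E.
  move=> a1 odd_l; rewrite /smallest_part E /= in a1; rewrite a1 in E.
  exists l.+1; split=> //.
  by rewrite (largest_part_iota (ltn0Sn l) E) in odd_l.
move=> [l [l0 odd_l E sn]]; split.
- split; last by apply/gap_freeP; exists 1, l.
  rewrite /is_partition_of -/(weight lam) sn eqxx andbT -mset_eq0.
  by move/values_iotaP: E => /(_ 0); lia.
- by rewrite /smallest_part E -(prednK l0).
- by rewrite (largest_part_iota l0 E).
Qed.

Lemma values_msetB_msetn (lam : {mset nat}) l k : 0 < l ->
  values lam = iota 1 l -> k < lam l ->
  values (lam `\` msetn k l)%mset = iota 1 l.
Proof.
move=> l0 /values_iotaP S kl; apply/values_iotaP => v.
by have := S v; rewrite !msetE; have [->|_] := eqVneq v l; lia.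
Qed.

(** Here [k = i - 1] counts both the deleted copies of [l] and the applications of [xi l]; the bound
    on [i] becomes [k < lam l], so one copy of [l] survives. *)
Lemma GsetP (lam mu : {mset nat}) l : 0 < l -> values lam = iota 1 l ->
  Gset lam mu <->
  exists2 k, k < lam l & mu = iter k (xi l) (lam `\` msetn k l)%mset.
Proof.
move=> l0 E; rewrite /Gset /varrho /rho_step /mult_largest.
rewrite (largest_part_iota l0 E) /ellbar E size_iota; split.
  by move=> [[|k] //= ik <-]; exists k.
by move=> [k kl ->]; exists k.+1.
Qed.

Theorem theorem5p4 (n : nat) (hn : 0 < n) :
  trivIset (GI' n) Gset /\
  G n `\` G0 n = \bigcup_(lam in GI' n) Gset lam.
Proof.
split.
  move=> lam lam' /(GI'P _ hn)[l [l0 ol E _]] /(GI'P _ hn)[l' [l'0 ol' E' _]].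
  move=> [mu [/(GsetP _ l0 E)[k kl Ek] /(GsetP _ l'0 E')[k' kl' Ek']]].
  have B := values_msetB_msetn l0 E kl.
  have B' := values_msetB_msetn l'0 E' kl'.
  (* The number of distinct parts of [mu] is both [l + e] and [l' + e'], so the even numbers [l] and
     [l'] differ by at most 1. *)
  have ll' : l = l'.
    have [[b _ [e Eb]] _] := values_iter_xi k l0 B.
    have [[b' _ [e' Eb']] _] :=
      values_iter_xi k' l'0 B'.
    move: Eb Eb'; rewrite -Ek -Ek' => -> /(congr1 size).
    by rewrite !size_iota; lia.
  subst l'; move: Ek; rewrite Ek' => /esym.
  move=> /(iter_xi_inj l0 B B')[kk' /nat_msetP X].
  (* The truncated subtraction at [l] cancels because [k] is below both multiplicities. *)
  subst k'; apply/nat_msetP => v; have := X v; rewrite !msetE.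
  by have [->|_] := eqVneq v l; lia.
apply/seteqP; split=> mu.
  move=> [[pmu gmu] G0mu].
  have /andP[mu0 /eqP sn] := pmu; have /gap_freeP[a [d E]] := gmu.
  (* One distinct value is excluded by [G0mu], none by [n > 0]. *)
  have d1 : 1 < d.
    have : d <> 1 by move=> d1; apply: G0mu; split; rewrite // /ellbar E d1.
    have : d <> 0.
      move=> d0; move: sn hn; rewrite /weight sum_mset.
      rewrite big_seq big1 => [<- //|v]; rewrite mem_finsupp -lt0n.
      by rewrite -mem_values E d0.
    lia.
  have a0 : 0 < a.
    move: mu0; rewrite -mset_eq0; move/values_iotaP: E => /(_ 0); lia.
  (* The even one among [d] and [d - 1]. *)
  pose l := d - odd d.
  have l0 : 0 < l by rewrite /l; lia.
  have El : values mu = iota a (l + odd d).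
    by rewrite E; congr iota; rewrite /l; lia.
  have [j [ka [Ek Ej]]] := iter_xi_surj l0 a0 El.
  have Sk := proj1 (@values_iotaP _ _ _) Ek.
  have Elam : values (ka `+` msetn j l)%mset = iota 1 l.
    apply/values_iotaP => v; have := Sk v; rewrite !msetE.
    by have [->|_] := eqVneq v l; lia.
  (* The [j] restored copies of [l] weigh [j * l], which is what the [j] steps from [ka] to [mu]
     gained, so the total is [n]. *)
  exists (ka `+` msetn j l)%mset.
    apply/(GI'P _ hn); exists l; split=> //; first by rewrite /l; lia.
    rewrite weightD weight_msetn.
    by have [_] := values_iter_xi j l0 Ek; rewrite -Ej => <-.
  apply/(GsetP _ l0 Elam); exists j.
    by rewrite !msetE eqxx; have := Sk l; lia.
  rewrite Ej; congr iter; apply/nat_msetP => v; rewrite !msetE; lia.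
move=> [lam /(GI'P _ hn)[l [l0 ol E sn]] /(GsetP _ l0 E)[k kl Ek]].
have B := values_msetB_msetn l0 E kl.
have [[b b1 [e Eb]] s] := values_iter_xi k l0 B.
rewrite -Ek in Eb s; split.
  split; last by apply/gap_freeP; exists b, (l + e).
  rewrite /is_partition_of -/(weight mu) -mset_eq0 s; apply/andP; split.
    by move/values_iotaP: Eb => /(_ 0); lia.
  (* The weight [k * l] gained by the iteration is that of the [k] deleted copies of [l]. *)
  rewrite -weight_msetn -weightD -sn; apply/eqP; congr weight.
  by apply/nat_msetP => v; rewrite !msetE; have [->|_] := eqVneq v l; lia.
(* Being even and positive, [l] is at least 2. *)
by move=> [_]; rewrite /ellbar Eb size_iota; lia.
Qed.
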